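(* Let $\mathcal{E}^1,\dots,\mathcal{E}^L$ be $m$-party quantum state ensembles. Then $$\prod_{l=1}^Lp_{\sf L}(\mathcal{E}^l)=p_{\sf L}\Big(\bigotimes_{l=1}^L\mathcal{E}^l\Big)=p_{\sf G}\Big(\bigotimes_{l=1}^L\mathcal{E}^l\Big)$$ if and only if $p_{\sf L}(\mathcal{E}^l)=p_{\sf G}(\mathcal{E}^l)$ for all $l=1,\dots,L$.
   Context: Each ensemble $\mathcal{E}^l=\{\eta^l_i,\rho^l_i\}_{i=1}^{n_l}$ consists of $m$-party states on $\mathcal{H}=\bigotimes_{k=1}^m\mathbb{C}^{d_k}$ ($m,d_k\ge2$) with nonzero probabilities summing to $1$. With $\mathbb{N}_{\vec n}=\{1,\dots,n_1\}\times\cdots\times\{1,\dots,n_L\}$, $\eta_{\vec c}=\prod_l\eta^l_{c_l}$, $\rho_{\vec c}=\bigotimes_l\rho^l_{c_l}$, the sequence ensemble is $\bigotimes_l\mathcal{E}^l=\{\eta_{\vec c},\rho_{\vec c}\}_{\vec c\in\mathbb{N}_{\vec n}}$ on $\mathcal{H}^{\otimes L}$, an $m$-party system where party $\mathsf{A}_k$ holds the $k$-th factor of every copy. A measurement is LOCC if realizable by local operations and classical communication among $\mathsf{A}_1,\dots,\mathsf{A}_m$. For an ensemble $\{\eta_j,\rho_j\}_j$, $p_{\sf G}$ and $p_{\sf L}$ denote the maximum of $\sum_j\eta_j\operatorname{Tr}(\rho_jM_j)$ over all measurements and over all LOCC measurements $\{M_j\}_j$ respectively. *)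

(* Defs.v *)
From HB Require Import structures.
From mathcomp Require Import all_boot all_order all_algebra.
From mathcomp Require Import complex.
From mathcomp Require Import classical_sets reals.
Set Implicit Arguments. Unset Strict Implicit. Unset Printing Implicit Defensive.
Import Order.TTheory GRing.Theory Num.Theory.
Local Open Scope ring_scope.

(* Operators on the Hilbert space C^T (T a finite orthonormal basis). *)
Definition op (R : realType) (T : finType) := T -> T -> R[i].

Definition op_one (R : realType) (T : finType) : op R T :=
  fun x y => if x == y then 1 else 0.

Definition op_mul (R : realType) (T : finType) (A B : op R T) : op R T :=
  fun x z => \sum_(y : T) A x y * B y z.

Definition op_adj (R : realType) (T : finType) (A : op R T) : op R T :=
  fun x y => (A y x)^*.

Definition op_tr (R : realType) (T : finType) (A : op R T) : R[i] :=
  \sum_(x : T) A x x.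

Definition psd (R : realType) (T : finType) (A : op R T) : Prop :=
  forall v : T -> R[i], 0 <= \sum_(x : T) \sum_(y : T) (v x)^* * A x y * v y.

Definition density (R : realType) (T : finType) (rho : op R T) : Prop :=
  psd rho /\ op_tr rho = 1.

Definition povm (R : realType) (T : finType) (J : finType) (M : J -> op R T)
  : Prop :=
  (forall j, psd (M j)) /\ (forall x y, \sum_(j : J) M j x y = @op_one R T x y).

Unset Implicit Arguments.
Record ensemble (R : realType) (T : finType) := Ensemble {
  e_idx : finType;
  e_eta : e_idx -> R;
  e_rho : e_idx -> op R T }.
Arguments e_idx {R T}.
Arguments e_eta {R T}.
Arguments e_rho {R T}.
Arguments Ensemble {R T}.
Set Implicit Arguments.

Definition valid_ensemble (R : realType) (T : finType) (E : ensemble R T)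
  : Prop :=
  (forall i, 0 < e_eta E i) /\ (\sum_(i : e_idx E) e_eta E i = 1) /\
  (forall i, density (e_rho E i)).

Definition succ (R : realType) (T : finType) (E : ensemble R T)
  (M : e_idx E -> op R T) : R :=
  \sum_(j : e_idx E) e_eta E j * complex.Re (op_tr (op_mul (e_rho E j) (M j))).

(* m parties; party k holds a local space with basis X k; the global basis
   is the product of the local ones. *)
Definition gbasis (m : nat) (X : 'I_m -> finType) : finType :=
  {dffun forall k : 'I_m, X k}.

(* a local operator A of party k, acting as A (x) identity on the others *)
Definition lift (R : realType) (m : nat) (X : 'I_m -> finType) (k : 'I_m)
  (A : op R (X k)) : op R (gbasis X) :=
  fun x y => if [forall k' : 'I_m, (k' != k) ==> (x k' == y k')]
             then A (x k) (y k) else 0.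

(* Finite-round LOCC POVMs with outcome set J, described by protocol trees:
   either the parties stop and output j0, or some party k performs a local
   instrument with Kraus operators A_i (sum_i A_i^* A_i = 1), broadcasts i,
   and the parties continue with an LOCC protocol N^i depending on i.
   The resulting POVM is M_j = sum_i A_i^* N^i_j A_i. *)
Inductive locc (R : realType) (m : nat) (X : 'I_m -> finType) (J : finType)
  : (J -> op R (gbasis X)) -> Prop :=
| locc_stop (j0 : J) :
    locc (fun j => if j == j0 then @op_one R (gbasis X) else (fun _ _ => 0))
| locc_round (k : 'I_m) (n : nat) (A : 'I_n -> op R (X k))
    (N : 'I_n -> J -> op R (gbasis X)) :
    (forall x y, \sum_(i < n) op_mul (op_adj (A i)) (A i) x y = @op_one R (X k) x y) ->
    (forall i, locc (N i)) ->
    locc (fun j x y => \sum_(i < n)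
           op_mul (op_adj (lift (A i))) (op_mul (N i j) (lift (A i))) x y).

Definition pG (R : realType) (T : finType) (E : ensemble R T) : R :=
  sup [set r | exists M : e_idx E -> op R T, povm M /\ r = @succ R _ E M].

Definition pL (R : realType) (m : nat) (X : 'I_m -> finType)
  (E : ensemble R (gbasis X)) : R :=
  sup [set r | exists M : e_idx E -> op R (gbasis X), locc M /\ r = @succ R _ E M].

Definition loc1 (m : nat) (d : 'I_m -> nat) : 'I_m -> finType :=
  fun k => 'I_(d k).
Definition Hb (m : nat) (d : 'I_m -> nat) : finType := gbasis (loc1 d).

(* H^{(x)L}: party k holds the k-th factor of each of the L copies *)
Definition locL (m : nat) (d : 'I_m -> nat) (L : nat) : 'I_m -> finType :=
  fun k => {ffun 'I_L -> 'I_(d k)}.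
Definition HbL (m : nat) (d : 'I_m -> nat) (L : nat) : finType :=
  gbasis (locL d L).

Definition copy (m : nat) (d : 'I_m -> nat) (L : nat) (l : 'I_L)
  (x : HbL d L) : Hb d :=
  [ffun k => (x k : {ffun 'I_L -> 'I_(d k)}) l].

Definition seq_ens (R : realType) (m : nat) (d : 'I_m -> nat) (L : nat)
  (E : 'I_L -> ensemble R (Hb d)) : ensemble R (HbL d L) :=
  @Ensemble R (HbL d L) {dffun forall l : 'I_L, e_idx (E l)}
    (fun c => \prod_(l < L) e_eta (E l) (c l))
    (fun c x y => \prod_(l < L) e_rho (E l) (c l) (copy l x) (copy l y)).

(* Main.v *)
(* Any operator [K] dominating all weighted states [eta_j rho_j] bounds the
   success probability of every measurement by [tr K].  Conversely, let [M] be
   optimal up to [t^2] and [K] the Hermitian part of [\sum_j eta_j rho_j M_j].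
   For a rank one projection [P], replacing each [M_j] by
   [(1 - t P) M_j (1 - t P)] and giving the freed weight to outcome [k] gains
   [2 t tr ((eta_k rho_k - K) P)] up to [O(t^2)]; near optimality thus forces
   [K + t] to dominate, and [pG] is the infimum of the traces of dominating
   operators.  Tensor products of dominating operators dominate, so [pG] is
   submultiplicative, while running optimal protocols copy by copy makes both
   [pL] and [pG] supermultiplicative.  The theorem follows from
   [0 < pL <= pG]. *)
Require Import Defs.
From HB Require Import structures.
From mathcomp Require Import all_boot all_order all_algebra.
From mathcomp Require Import complex.
From mathcomp Require Import boolp classical_sets functions reals.
From mathcomp Require Import topology normedtype.
From mathcomp Require Import sesquilinear spectral ring.
Set Implicit Arguments. Unset Strict Implicit. Unset Printing Implicit Defensive.
Import Order.TTheory GRing.Theory Num.Theory numFieldTopology.Exports.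
Local Open Scope ring_scope.
Local Open Scope sesquilinear_scope.

(** * Products of suprema *)

Lemma closed_prod_closure (R : numFieldType) (I : finType) (Q : set R)
    (S : I -> set R) (s : I -> R) :
  closed Q -> (forall i, closure (S i) (s i)) ->
  (forall r : I -> R, (forall i, S i (r i)) -> Q (\prod_i r i)) ->
  Q (\prod_i s i).
Proof.
move=> clQ clS QS.
suff mixed (t : seq I) : forall r : I -> R,
    (forall i, if i \in t then r i = s i else S i (r i)) -> Q (\prod_i r i).
  by apply: (mixed (enum I)) => i; rewrite mem_enum.
elim: t => [|i t IH] r hr; first exact: QS.
have [it|it] := boolP (i \in t).
  apply: IH => j; have := hr j; rewrite inE.
  by case: eqP => [->|//]; rewrite it.
have rE j : j != i -> if j \in t then r j = s j else S j (r j).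
  by move=> ji; have := hr j; rewrite inE (negPf ji).
pose c := \prod_(j | j != i) r j.
have prodE x : \prod_j (if j == i then x else r j) = x * c.
  by rewrite (bigD1 i) //= eqxx; congr (_ * _); apply: eq_bigr => j /negPf ->.
have clQi : closed [set x | Q (x * c)]%classic.
  by apply: preimage_closed clQ => x _; exact: mulrr_continuous.
have -> : \prod_j r j = s i * c.
  by rewrite (bigD1 i) //=; have := hr i; rewrite mem_head => ->.
have SQ : (S i `<=` [set x | Q (x * c)])%classic.
  move=> x Sx; rewrite /= -prodE; apply: IH => j.
  by have [->|/rE //] := eqVneq j i; rewrite (negPf it).
by have := closureS SQ (clS i); rewrite -(closure_id _).1.
Qed.

Lemma prod_sup_le (R : realType) (I : finType) (S : I -> set R) (u : R) :
  (forall i, has_sup (S i)) ->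
  (forall r : I -> R, (forall i, S i (r i)) -> \prod_i r i <= u) ->
  \prod_i sup (S i) <= u.
Proof.
move=> supS; apply: (@closed_prod_closure _ _ [set x | x <= u]%classic S).
  exact: closed_le.
by move=> i; have [S0 Sub] := supS i; exact: closure_sup.
Qed.

Lemma ler_prod_eq (R : numDomainType) (I : finType) (a b : I -> R) :
  (forall i, 0 < a i <= b i) -> \prod_i b i <= \prod_i a i ->
  forall i, a i = b i.
Proof.
move=> ab ba i; have /andP[ai0 abi] := ab i.
have prod_a_gt0 : 0 < \prod_(j | j != i) a j.
  by apply: prodr_gt0 => j _; case/andP: (ab j).
apply/eqP; rewrite eq_le abi -(ler_pM2r prod_a_gt0).
move: ba; rewrite (bigD1 i) //= [leRHS](bigD1 i) //=; apply: le_trans.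
rewrite ler_pM2l ?(lt_le_trans ai0) //.
by apply: ler_prod => j _; have /andP[/ltW -> ->] := ab j.
Qed.

(** * Positive semidefinite matrices *)

Section PsdMatrix.
Variable C : numClosedFieldType.

Lemma adjmxM m n p (A : 'M[C]_(m, n)) (B : 'M[C]_(n, p)) :
  (A *m B)^t* = B^t* *m A^t*.
Proof. by rewrite trmx_mul map_mxM. Qed.

Lemma adjmxD m n (A B : 'M[C]_(m, n)) : (A + B)^t* = A^t* + B^t*.
Proof. by rewrite linearD map_mxD. Qed.

Lemma adjmxB m n (A B : 'M[C]_(m, n)) : (A - B)^t* = A^t* - B^t*.
Proof. by rewrite linearB map_mxB. Qed.

Lemma adjmxZ m n a (A : 'M[C]_(m, n)) : (a *: A)^t* = a^* *: A^t*.
Proof. by rewrite linearZ /= map_mxZ. Qed.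

Definition qform n (A : 'M[C]_n) (u : 'cV[C]_n) : C := (u^t* *m A *m u) 0 0.

Definition psdmx n (A : 'M[C]_n) : Prop := forall u, 0 <= qform A u.

Lemma psdmx_conj m n (A : 'M[C]_m) (X : 'M[C]_(m, n)) :
  psdmx A -> psdmx (X^t* *m A *m X).
Proof. by move=> hA u; have := hA (X *m u); rewrite /qform adjmxM !mulmxA. Qed.

Section Square.
Variable n : nat.
Implicit Types (A B P : 'M[C]_n) (u v : 'cV[C]_n).

Lemma qform_tr A u : qform A u = \tr (A *m (u *m u^t*)).
Proof. by rewrite mulmxA mxtrace_mulC mulmxA trace_mx11. Qed.

Lemma qform_adj A u : qform (A^t*) u = (qform A u)^*.
Proof.
rewrite /qform; have -> : u^t* *m A^t* *m u = (u^t* *m A *m u)^t*.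
  by rewrite !adjmxM trmxCK mulmxA.
by rewrite !mxE.
Qed.

Lemma qform_delta A i : qform A (delta_mx i 0) = A i i.
Proof. by rewrite /qform trmx_delta map_delta_mx -rowE -colE !mxE. Qed.

Lemma qform1E u : qform 1%:M u = dotmx (u^t*) (u^t*).
Proof. by rewrite /qform mulmx1 dotmxE trmxCK. Qed.

Lemma qform_eq0 A : (forall u, qform A u = 0) -> A = 0.
Proof.
move=> A0; pose b u v := (u^t* *m A *m v) 0 0.
have polar c u v : c * b u v + c^* * b v u = 0.
  have := A0 (u + c *: v); rewrite /qform adjmxD adjmxZ !mulmxDl !mulmxDr.
  rewrite -!scalemxAr -!scalemxAl.
  have := A0 u; have := A0 v; rewrite /qform /b !mxE => -> ->.
  by rewrite !mulr0 add0r addr0.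
have b0 u v : b u v = 0.
  have := polar 1 u v; have := polar 'i u v.
  rewrite conjC1 conjCi !mul1r mulNr -mulrBr => /eqP.
  rewrite mulf_eq0 (negPf (neq0Ci C)) /= subr_eq0 => /eqP <- /eqP.
  by rewrite -mulr2n mulrn_eq0 => /eqP.
apply/matrixP => i j; have := b0 (delta_mx i 0) (delta_mx j 0).
by rewrite /b trmx_delta map_delta_mx -rowE -colE !mxE.
Qed.

Lemma psdmx_adj A : psdmx A -> A^t* = A.
Proof.
move=> hA; apply/subr0_eq/qform_eq0 => u.
rewrite qform_tr mulmxBl raddfB /= -!qform_tr qform_adj.
by apply/eqP; rewrite subr_eq0; apply/eqP/CrealP/ger0_real.
Qed.

Lemma psdmxD A B : psdmx A -> psdmx B -> psdmx (A + B).
Proof.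
by move=> hA hB u; rewrite qform_tr mulmxDl raddfD /= -!qform_tr addr_ge0.
Qed.

Lemma psdmxZ a A : 0 <= a -> psdmx A -> psdmx (a *: A).
Proof.
by move=> a0 hA u; rewrite qform_tr -scalemxAl mxtraceZ -qform_tr mulr_ge0.
Qed.

Lemma psdmx0 : psdmx (0 : 'M[C]_n).
Proof. by move=> u; rewrite qform_tr mul0mx mxtrace0. Qed.

Lemma psdmx1 : psdmx (1%:M : 'M[C]_n).
Proof. by move=> u; rewrite qform1E; exact: dnorm_ge0. Qed.

Lemma psdmx_tr_ge0 A : psdmx A -> 0 <= \tr A.
Proof. by move=> hA; apply: sumr_ge0 => i _; rewrite -qform_delta. Qed.

Lemma psdmx_gramP A : psdmx A -> exists X : 'M[C]_n, A = X^t* *m X.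
Proof.
move=> hA.
have /hermitian_normalmx/orthomx_spectralP : A \is hermsymmx.
  by apply/is_hermitianmxP; rewrite expr0 scale1r psdmx_adj.
set P := spectralmx A; set d := spectral_diag A.
have PU : P \is unitarymx := spectral_unitarymx A.
rewrite invmx_unitary // => AE.
have PAP : diag_mx d = P *m A *m P^t*.
  by rewrite AE !mulmxA (unitarymxP PU) mul1mx mulmxtVK.
have d_ge0 i : 0 <= d 0 i.
  have := psdmx_conj (P^t*) hA (delta_mx i 0); rewrite trmxCK -PAP qform_delta.
  by rewrite mxE eqxx.
exists (diag_mx (map_mx sqrtC d) *m P).
rewrite adjmxM tr_diag_mx map_diag_mx mulmxA -[X in X *m P]mulmxA mulmx_diag.
rewrite {1}AE; congr (_ *m diag_mx _ *m _); apply/rowP => i; rewrite !mxE /=.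
by rewrite geC0_conj ?sqrtC_ge0 // -expr2 sqrtCK.
Qed.

Lemma psdmx_trM_ge0 A B : psdmx A -> psdmx B -> 0 <= \tr (A *m B).
Proof.
move=> hA /psdmx_gramP[X ->]; rewrite mulmxA mxtrace_mulC mulmxA.
by have := psdmx_tr_ge0 (psdmx_conj (X^t*) hA); rewrite trmxCK.
Qed.

Definition projmx P : Prop := P^t* = P /\ P *m P = P.

Lemma projmx_psd P : projmx P -> psdmx P.
Proof.
by case=> adjP PP; rewrite -PP -{1}adjP -[P^t*]mulmx1; exact/psdmx_conj/psdmx1.
Qed.

Lemma projmxC P : projmx P -> projmx (1%:M - P).
Proof.
case=> adjP PP; split; first by rewrite adjmxB adjP trmx1 map_mx1.
by rewrite mulmxBl mul1mx mulmxBr mulmx1 PP subrr subr0.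
Qed.

Lemma tr_mulmx_proj_le A P : psdmx A -> projmx P -> \tr (A *m P) <= \tr A.
Proof.
move=> hA /projmxC/projmx_psd/(psdmx_trM_ge0 hA).
by rewrite mulmxBr mulmx1 raddfB subr_ge0.
Qed.

Lemma psdmx_rank1_proj A :
  (forall P, projmx P -> \tr P = 1 -> 0 <= \tr (A *m P)) -> psdmx A.
Proof.
move=> hA v; have [->|v0] := eqVneq v 0; first by rewrite /qform mulmx0 mxE.
set N := qform 1%:M v.
have N_gt0 : 0 < N.
  rewrite /N qform1E dnorm_gt0; apply: contra_neq v0 => v0.
  by rewrite -[v]trmxCK v0 trmx0 map_mx0.
have N_neq0 : N != 0 by rewrite gt_eqF.
have trN : \tr (v *m v^t*) = N by rewrite /N qform_tr mul1mx.
have vv : v *m v^t* *m (v *m v^t*) = N *: (v *m v^t*).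
  rewrite mulmxA -[v *m v^t* *m v]mulmxA [v^t* *m v]mx11_scalar mul_mx_scalar.
  by rewrite -scalemxAl /N /qform mulmx1.
have projP : projmx (N^-1 *: (v *m v^t*)).
  split; first by rewrite adjmxZ adjmxM trmxCK geC0_conj // invr_ge0 ltW.
  by rewrite -scalemxAl -scalemxAr vv scalerK.
have := hA _ projP; rewrite mxtraceZ trN mulVf // => /(_ erefl).
by rewrite -scalemxAr mxtraceZ -qform_tr pmulr_rge0 ?invr_gt0.
Qed.

Lemma mxtrace_compress A B P t :
  \tr (A *m ((1%:M - t *: P) *m B *m (1%:M - t *: P))) =
  \tr (A *m B) - t * \tr ((A *m B + B *m A) *m P)
    + t ^+ 2 * \tr (A *m (P *m B *m P)).
Proof.
rewrite !(mulmxBl, mulmxBr, mul1mx, mulmx1) -!(scalemxAl, scalemxAr).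
rewrite !raddfB /= !mxtraceZ mulmxDl raddfD /= !mulmxA.
rewrite [\tr (A *m P *m B)]mxtrace_mulC !mulmxA.
by ring.
Qed.

End Square.

(** * Perturbing a nearly optimal measurement *)

Section Score.
Variables (n : nat) (J : finType) (W : J -> 'M[C]_n).
Implicit Types (M : J -> 'M[C]_n) (P : 'M[C]_n).

Definition povmx M : Prop := (forall j, psdmx (M j)) /\ \sum_j M j = 1%:M.

Definition score M : C := \sum_j \tr (W j *m M j).

Definition multiplier M : 'M[C]_n :=
  2%:R^-1 *: \sum_j (W j *m M j + M j *m W j).

Lemma tr_multiplier M : \tr (multiplier M) = score M.
Proof.
rewrite mxtraceZ raddf_sum.
under eq_bigr do rewrite /= raddfD /= [\tr (M _ *m _)]mxtrace_mulC -mulr2n.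
by rewrite sumrMnl -/(score M); field.
Qed.

(* The term added at [k] is the weight [1 - (1 - t P)^2] freed by compressing
   with [1 - t P]. *)
Definition perturb M k P (t : C) (j : J) : 'M[C]_n :=
  (1%:M - t *: P) *m M j *m (1%:M - t *: P) +
  (if j == k then (t *+ 2 - t ^+ 2) *: P else 0).

Lemma perturb_povmx M k P t :
  povmx M -> projmx P -> 0 <= t <= 2%:R -> povmx (perturb M k P t).
Proof.
move=> [M_psd M_sum] projP /andP[t0 t2]; split=> [j|].
  apply: psdmxD.
    have {1}-> : 1%:M - t *: P = (1%:M - t *: P)^t*.
      by rewrite adjmxB adjmxZ projP.1 geC0_conj // trmx1 map_mx1.
    exact: psdmx_conj.
  case: eqP => _; [apply: psdmxZ | exact: psdmx0]; last exact: projmx_psd.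
  by rewrite -mulr_natr expr2 -mulrBr mulr_ge0 // subr_ge0.
rewrite big_split /= -mulmx_suml -mulmx_sumr M_sum mulmx1.
rewrite -big_mkcond big_pred1_eq mulmxBl mul1mx mulmxBr mulmx1.
rewrite -scalemxAl -scalemxAr projP.2.
by apply/matrixP => i j; rewrite !mxE; ring.
Qed.

Lemma score_perturb M k P t : projmx P ->
  score (perturb M k P t) =
  score M + t *+ 2 * \tr ((W k - multiplier M) *m P)
    + t ^+ 2 * (\sum_j \tr (W j *m (P *m M j *m P)) - \tr (W k *m P)).
Proof.
move=> projP; rewrite /score.
under eq_bigr do rewrite mulmxDr raddfD /= mxtrace_compress.
rewrite !big_split sumrN /= -!mulr_sumr.
have -> : \sum_j \tr (W j *m (if j == k then (t *+ 2 - t ^+ 2) *: P else 0)) =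
    (t *+ 2 - t ^+ 2) * \tr (W k *m P).
  rewrite (bigD1 k) //= eqxx -scalemxAr mxtraceZ big1 ?addr0 // => j /negPf ->.
  by rewrite mulmx0 mxtrace0.
have -> : \sum_j \tr ((W j *m M j + M j *m W j) *m P) =
    2%:R * \tr (multiplier M *m P).
  by rewrite -scalemxAl mxtraceZ mulVKf ?pnatr_eq0 // mulmx_suml raddf_sum.
by rewrite mulmxBl raddfB /=; ring.
Qed.

Hypothesis W_psd : forall j, psdmx (W j).
Hypothesis W_tr_le1 : forall j, \tr (W j) <= 1.

Lemma near_optimal_dual M t : 0 < t <= 2%:R -> povmx M ->
  (forall N, povmx N -> score N <= score M + t ^+ 2) ->
  forall k, psdmx (multiplier M + t%:M - W k).
Proof.
move=> /andP[t0 t2] hM opt k; apply: psdmx_rank1_proj => P projP trP.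
have t02 : 0 <= t <= 2%:R by rewrite ltW.
have PMP_ge0 : 0 <= \sum_j \tr (W j *m (P *m M j *m P)).
  apply: sumr_ge0 => j _; apply: psdmx_trM_ge0 => //.
  by rewrite -{1}projP.1; exact/psdmx_conj/hM.1.
have WP_le1 : \tr (W k *m P) <= 1.
  by apply: le_trans (W_tr_le1 k); exact: tr_mulmx_proj_le.
have := opt _ (perturb_povmx k hM projP t02).
rewrite score_perturb // -addrA lerD2l => gain.
have {gain} : t *+ 2 * \tr ((W k - multiplier M) *m P) <= t *+ 2 * t.
  have -> : t *+ 2 * t = t ^+ 2 + t ^+ 2 by ring.
  rewrite -lerBlDr; apply: le_trans gain; rewrite lerD2l.
  rewrite -[leLHS]mulrN1 ler_pM2l ?exprn_gt0 //.
  by rewrite -[leLHS]add0r lerD // lerN2.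
rewrite ler_pM2l ?pmulrn_lgt0 // => gain.
rewrite addrAC mulmxDl raddfD /= mul_scalar_mx mxtraceZ trP mulr1.
by rewrite -opprB mulNmx raddfN /= addrC subr_ge0.
Qed.

End Score.
End PsdMatrix.

(** * Operators as matrices *)

HB.instance Definition _ (R : realType) (T : finType) :=
  GRing.Lmodule.copy (op R T) (T -> T -> R[i]^o).

Section OpMatrix.
Variables (R : realType) (T : finType).
Implicit Types (A B X : op R T) (I : finType).
Local Notation one := (@op_one R T).

Lemma opP A B : (forall x y, A x y = B x y) <-> A = B.
Proof. by split=> [AB|->//]; apply/funext => x; apply/funext => y. Qed.

Lemma op_sumE I (F : I -> op R T) x y : (\sum_i F i) x y = \sum_i F i x y.
Proof. by rewrite !fct_sumE. Qed.

Definition opmx A : 'M[R[i]]_#|T| :=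
  \matrix_(i, j) A (enum_val i) (enum_val j).

Definition mxop (M : 'M[R[i]]_#|T|) : op R T :=
  fun x y => M (enum_rank x) (enum_rank y).

Lemma opmxK : cancel opmx mxop.
Proof. by move=> A; apply/opP => x y; rewrite /mxop mxE !enum_rankK. Qed.

Lemma mxopK : cancel mxop opmx.
Proof. by move=> M; apply/matrixP => i j; rewrite mxE /mxop !enum_valK. Qed.

Fact opmx_is_linear : linear opmx.
Proof. by move=> a A B; apply/matrixP => i j; rewrite !mxE. Qed.

HB.instance Definition _ :=
  GRing.isLinear.Build R[i] (op R T) 'M[R[i]]_#|T| _ opmx opmx_is_linear.

Lemma sum_enum_val (V : nmodType) (F : T -> V) :
  \sum_x F x = \sum_(i < #|T|) F (enum_val i).
Proof. by rewrite (reindex _ (onW_bij _ (@enum_val_bij T))). Qed.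

Lemma opmxM A B : opmx (op_mul A B) = opmx A *m opmx B.
Proof.
apply/matrixP => i j; rewrite !mxE /op_mul sum_enum_val.
by apply: eq_bigr => k _; rewrite !mxE.
Qed.

Lemma opmx1 : opmx one = 1%:M.
Proof.
apply/matrixP => i j; rewrite !mxE /op_one (inj_eq enum_val_inj).
by case: eqP.
Qed.

Lemma opmx_adj A : opmx (op_adj A) = (opmx A)^t*.
Proof. by apply/matrixP => i j; rewrite !mxE. Qed.

Lemma op_trE A : op_tr A = \tr (opmx A).
Proof.
by rewrite /op_tr /mxtrace sum_enum_val; apply: eq_bigr => k _; rewrite !mxE.
Qed.

Lemma qform_opmx A u :
  qform (opmx A) u = \sum_x \sum_y
    (u (enum_rank x) 0)^* * A x y * u (enum_rank y) 0.
Proof.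
rewrite /qform mxE [RHS]exchange_big [RHS]sum_enum_val /=.
apply: eq_bigr => j _; rewrite mxE big_distrl [RHS]sum_enum_val /=.
by apply: eq_bigr => i _; rewrite !mxE !enum_valK.
Qed.

Lemma psdE A : psd A <-> psdmx (opmx A).
Proof.
split=> [hA u|hA v]; first by rewrite qform_opmx; exact: hA.
have := hA (\col_i v (enum_val i)); rewrite qform_opmx.
by under eq_bigr do under eq_bigr do rewrite !mxE !enum_rankK.
Qed.

Lemma op_mul1 : right_id one (@op_mul R T).
Proof. by move=> A; apply: (can_inj opmxK); rewrite opmxM opmx1 mulmx1. Qed.

Lemma op_1mul : left_id one (@op_mul R T).
Proof. by move=> A; apply: (can_inj opmxK); rewrite opmxM opmx1 mul1mx. Qed.

Lemma op_mulA : associative (@op_mul R T).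
Proof. by move=> A B X; apply: (can_inj opmxK); rewrite !opmxM mulmxA. Qed.

Lemma op_mul0 A : op_mul A 0 = 0.
Proof. by apply: (can_inj opmxK); rewrite opmxM raddf0 mulmx0. Qed.

Lemma op_0mul A : op_mul 0 A = 0.
Proof. by apply: (can_inj opmxK); rewrite opmxM raddf0 mul0mx. Qed.

Lemma op_mul_suml I (F : I -> op R T) B :
  op_mul (\sum_i F i) B = \sum_i op_mul (F i) B.
Proof.
apply: (can_inj opmxK); rewrite opmxM !linear_sum mulmx_suml.
by apply: eq_bigr => i _; rewrite /= opmxM.
Qed.

Lemma op_mul_sumr I A (F : I -> op R T) :
  op_mul A (\sum_i F i) = \sum_i op_mul A (F i).
Proof.
apply: (can_inj opmxK); rewrite opmxM !linear_sum.
by apply: eq_bigr => i _; rewrite /= opmxM.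
Qed.

Lemma op_adj1 : op_adj one = one.
Proof. by apply: (can_inj opmxK); rewrite opmx_adj opmx1 trmx1 map_mx1. Qed.

Lemma psd0 : psd (0 : op R T).
Proof. by apply/psdE; rewrite linear0; exact: psdmx0. Qed.

Lemma psd_one : psd one.
Proof. by apply/psdE; rewrite opmx1; exact: psdmx1. Qed.

Lemma psdD A B : psd A -> psd B -> psd (A + B).
Proof.
move=> /psdE hA /psdE hB; apply/psdE; rewrite raddfD.
exact: psdmxD hA hB.
Qed.

Lemma psd_sum I (P : pred I) (F : I -> op R T) :
  (forall i, P i -> psd (F i)) -> psd (\sum_(i | P i) F i).
Proof. by move=> hF; apply: big_ind => //; [exact: psd0 | exact: psdD]. Qed.

Lemma psdZ (a : R[i]) A : 0 <= a -> psd A -> psd (a *: A).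
Proof. by move=> a0 /psdE hA; apply/psdE; rewrite linearZ; exact: psdmxZ. Qed.

Lemma psd_conj A X : psd A -> psd (op_mul (op_adj X) (op_mul A X)).
Proof.
move=> /psdE hA; apply/psdE; rewrite !opmxM opmx_adj mulmxA.
exact: psdmx_conj.
Qed.

Lemma psd_gramP A : psd A -> exists X, A = op_mul (op_adj X) X.
Proof.
move=> /psdE /psdmx_gramP[X AE]; exists (mxop X).
by apply: (can_inj opmxK); rewrite opmxM opmx_adj mxopK.
Qed.

Lemma psd_trM_ge0 A B : psd A -> psd B -> 0 <= op_tr (op_mul A B).
Proof. by move=> /psdE hA /psdE hB; rewrite op_trE opmxM psdmx_trM_ge0. Qed.

Lemma psd_tr_ge0 A : psd A -> 0 <= op_tr A.
Proof. by move=> /psdE hA; rewrite op_trE psdmx_tr_ge0. Qed.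

Section Povm.
Variable J : finType.
Implicit Type M : J -> op R T.

Lemma povmP M : povm M <-> (forall j, psd (M j)) /\ \sum_j M j = one.
Proof.
split=> -[M_psd M1]; split=> //.
  by apply/opP => x y; rewrite op_sumE M1.
by move=> x y; rewrite -M1 op_sumE.
Qed.

Lemma povm_mx M : povm M <-> povmx (fun j => opmx (M j)).
Proof.
have sumE : \sum_j opmx (M j) = opmx (\sum_j M j) by rewrite linear_sum.
split=> [/povmP[M_psd M1]|[M_psd M1]].
  by split=> [j|]; [exact/psdE | rewrite sumE M1 opmx1].
apply/povmP; split=> [j|]; first exact/psdE.
by apply: (can_inj opmxK); rewrite -sumE M1 opmx1.
Qed.

Definition const_meas (j0 j : J) : op R T := if j == j0 then one else 0.

Definition meas_class (P : (J -> op R T) -> Prop) : Prop :=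
  (forall j0, P (const_meas j0)) /\ (forall M, P M -> povm M).

Lemma const_meas_povm j0 : povm (const_meas j0).
Proof.
apply/povmP; split=> [j|]; last by rewrite -big_mkcond big_pred1_eq.
by rewrite /const_meas; case: eqP => _; [exact: psd_one | exact: psd0].
Qed.

Lemma meas_class_povm : meas_class (@povm R T J).
Proof. by split=> // j0; exact: const_meas_povm. Qed.

End Povm.
End OpMatrix.
Arguments const_meas {R T J}.
Arguments meas_class_povm {R T J}.

(** * Duality for state discrimination *)

Section Discrimination.
Variables (R : realType) (T : finType) (E : ensemble R T).
Hypothesis vE : valid_ensemble E.
Implicit Types (M : e_idx E -> op R T) (K : op R T).

Definition weighted (j : e_idx E) : op R T := (e_eta E j)%:C%C *: e_rho E j.

Definition dominates K : Prop := forall j, psd (K - weighted j).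

Lemma psd_weighted j : psd (weighted j).
Proof. by apply: psdZ; [rewrite ler0c ltW // vE.1 | have [] := vE.2.2 j]. Qed.

Lemma op_tr_weighted j : op_tr (weighted j) = (e_eta E j)%:C%C.
Proof.
by rewrite op_trE linearZ /= mxtraceZ -op_trE (vE.2.2 j).2 mulr1.
Qed.

Lemma eta_le1 j : e_eta E j <= 1.
Proof.
rewrite -vE.2.1 (bigD1 j) //= lerDl sumr_ge0 // => i _.
exact/ltW/vE.1.
Qed.

Lemma succ_score M : povm M ->
  (@succ R T E M)%:C%C =
  score (fun j => opmx (weighted j)) (fun j => opmx (M j)).
Proof.
move=> [M_psd _]; rewrite /succ rmorph_sum; apply: eq_bigr => j _ /=.
rewrite rmorphM /= RRe_real; last first.
  by apply/ger0_real/psd_trM_ge0 => //; exact: (vE.2.2 j).1.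
by rewrite op_trE opmxM linearZ /= -scalemxAl mxtraceZ.
Qed.

Lemma idx_inhabited : inhabited (e_idx E).
Proof.
have [j _|noj] := pickP (mem (e_idx E)); first by exists.
by have := vE.2.1; rewrite big_pred0 // => /esym/eqP; rewrite oner_eq0.
Qed.

Lemma dominates_psd K : dominates K -> psd K.
Proof.
move=> hK; have [j] := idx_inhabited; rewrite -[K](subrK (weighted j)).
by apply: psdD; [exact: hK | exact: psd_weighted].
Qed.

Lemma dominates_sum : dominates (\sum_j weighted j).
Proof.
move=> j; rewrite (bigD1 j) //= addrAC subrr add0r.
by apply: psd_sum => i _; exact: psd_weighted.
Qed.

Lemma weak_duality K M :
  dominates K -> povm M -> (@succ R T E M)%:C%C <= op_tr K.
Proof.
move=> hK hM; have [M_psd M1] := (povm_mx M).1 hM.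
rewrite succ_score // op_trE -[opmx K]mulmx1 -M1 mulmx_sumr raddf_sum.
apply: ler_sum => j _; rewrite -subr_ge0 -raddfB -mulmxBl -linearB.
by apply: psdmx_trM_ge0; [exact/psdE/hK | exact: M_psd].
Qed.

Definition dual_values : set R :=
  [set complex.Re (op_tr K) | K in dominates]%classic.

Lemma succ_le_dual M r : povm M -> dual_values r -> @succ R T E M <= r.
Proof.
move=> hM [K hK <-]; rewrite -lecR RRe_real; first exact: weak_duality.
exact/ger0_real/psd_tr_ge0/dominates_psd.
Qed.

Lemma succ_const_meas j : @succ R T E (const_meas j) = e_eta E j.
Proof.
rewrite /succ /const_meas (bigD1 j) //= eqxx op_mul1 (vE.2.2 j).2 mulr1.
rewrite big1 ?addr0 // => i /negPf ->.
by rewrite op_mul0 op_trE raddf0 mxtrace0 mulr0.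
Qed.

Definition success_values (P : (e_idx E -> op R T) -> Prop) : set R :=
  [set r | exists M, P M /\ r = @succ R T E M]%classic.

Section MeasClass.
Variable P : (e_idx E -> op R T) -> Prop.
Hypothesis classP : meas_class P.

Lemma has_sup_success : has_sup (success_values P).
Proof.
have [j] := idx_inhabited; split.
  by exists (succ (const_meas j)), (const_meas j); split=> //; exact: classP.1.
exists (complex.Re (op_tr (\sum_j weighted j))) => _ [M [/classP.2 hM ->]].
apply: succ_le_dual hM _; exists (\sum_j weighted j) => //.
exact: dominates_sum.
Qed.

Lemma succ_le_sup M : P M -> @succ R T E M <= sup (success_values P).
Proof.
by move=> hM; apply: ub_le_sup; [exact: has_sup_success.2 | exists M].
Qed.

Lemma sup_success_gt0 : 0 < sup (success_values P).
Proof.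
have [j] := idx_inhabited; apply: lt_le_trans (succ_le_sup (classP.1 j)).
by rewrite succ_const_meas vE.1.
Qed.

End MeasClass.

Lemma succ_le_pG M : povm M -> @succ R T E M <= pG E.
Proof. exact/succ_le_sup/meas_class_povm. Qed.

Lemma sup_success_le_pG P : meas_class P -> sup (success_values P) <= pG E.
Proof.
move=> classP; apply: ge_sup; first exact: (has_sup_success classP).1.
by move=> _ [M [/classP.2 hM ->]]; exact: succ_le_pG.
Qed.

(* A measurement optimal up to [t^2] yields the dual candidate [multiplier + t];
   its trace exceeds the score by [t] times the dimension. *)
Lemma strong_duality (e : R) : 0 < e ->
  exists2 r, dual_values r & r <= pG E + e.
Proof.
move=> e_gt0; pose t := Num.min (e / #|T|.+1%:R) 1.
have t_gt0 : 0 < t by rewrite lt_min ltr01 divr_gt0 // ltr0n.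
have tT_le : t *+ #|T| <= e.
  apply: (@le_trans _ _ (t * #|T|.+1%:R)).
    by rewrite -[leLHS]mulr_natr ler_wpM2l ?ler_nat // ltW.
  by rewrite -ler_pdivlMr ?ltr0n // ge_min lexx.
have [_ [M [hM ->]] near_opt] :=
  sup_adherent (exprn_gt0 2 t_gt0) (has_sup_success meas_class_povm).
pose W j := opmx (weighted j); pose N j := opmx (M j).
pose K := multiplier W N + (t%:C%C)%:M.
exists (complex.Re (op_tr (mxop K))).
  exists (mxop K) => // j; apply/psdE; rewrite linearB /= mxopK.
  apply: near_optimal_dual => [i|i|||N' hN'].
  - exact/psdE/psd_weighted.
  - by rewrite /W -op_trE op_tr_weighted lecR eta_le1.
  - have -> : 2%:R = (2%:R : R)%:C%C by rewrite rmorph_nat.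
    by rewrite ltcR lecR t_gt0 ge_min [1 <= _]ler1n orbT.
  - exact/povm_mx.
  have N'E : N' = fun j => opmx (mxop (N' j)).
    by apply/funext => i; rewrite mxopK.
  have hM' : povm (fun j => mxop (N' j)) by apply/povm_mx; rewrite -N'E.
  rewrite N'E -!succ_score // -rmorphXn -rmorphD lecR.
  by rewrite -lerBlDr (le_trans _ (ltW near_opt)) // lerD2r succ_le_pG.
rewrite op_trE mxopK raddfD /= tr_multiplier -succ_score // mxtrace_scalar.
by rewrite raddfD /= -rmorphMn /= lerD // succ_le_pG.
Qed.

Lemma pG_le_dual r : dual_values r -> pG E <= r.
Proof.
move=> hr; apply: ge_sup; first by have [] := has_sup_success meas_class_povm.
by move=> _ [M [hM ->]]; exact: succ_le_dual.
Qed.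

Lemma pG_closure_dual : closure dual_values (pG E).
Proof.
move=> B /nbhs_ballP[e /= e_gt0 ballB].
have [r dual_r r_le] := strong_duality (divr_gt0 e_gt0 (ltr0n _ 2)).
exists r; split=> //; apply: ballB.
rewrite /ball /= distrC ger0_norm ?subr_ge0 ?pG_le_dual //.
by rewrite ltrBlDl (le_lt_trans r_le) // ltrD2l gtr_pMr // invf_lt1 ?ltr1n.
Qed.

End Discrimination.

(** * Operators on product systems *)

Lemma sum_dffun_prod (K : comNzRingType) (I : finType) (J : I -> finType)
    (F : forall i, J i -> K) :
  \sum_(c : {dffun forall i, J i}) \prod_i F i (c i) = \prod_i \sum_j F i j.
Proof.
rewrite (reindex _ (onW_bij _ (@dffun_of_fprod_bij _ J))).
pose G i : {ffun J i -> K} := [ffun j => F i j].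
under eq_bigr => c _ do under eq_bigr => i _ do
  rewrite ffunE -[F i _](ffunE (F i)) -/(G i).
rewrite (big_fprod _ _ G); apply/esym.
rewrite -[RHS](bigA_distr_big_dep (fun i u => u \in tagged_with J i)
  (fun i u => untag 0 (G i) u)).
apply: eq_bigr => i _; rewrite -(big_tag (fun i => G i)).
by apply: eq_bigr => j _; rewrite ffunE.
Qed.

Section Product.
Variables (R : realType) (I S : finType) (T : I -> finType).
Variable pr : forall i, S -> T i.
Implicit Types B D : forall i, op R (T i).

Definition coords (x : S) : {dffun forall i, T i} := [ffun i => pr i x].

Definition product_system : Prop := bijective coords.

Definition tens B : op R S := fun x y => \prod_i B i (pr i x) (pr i y).

Definition tens_at i (A : op R (T i)) : op R S :=
  tens (dfwith (fun i => @op_one R (T i)) A).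

Lemma eq_tens B D : (forall i, B i = D i) -> tens B = tens D.
Proof. by move=> BD; congr tens; exact/functional_extensionality_dep. Qed.

Lemma tens_adj B : op_adj (tens B) = tens (fun i => op_adj (B i)).
Proof. by apply/opP => x y; rewrite /op_adj /tens rmorph_prod. Qed.

Lemma tens_dfwithE B i (A : op R (T i)) x y :
  tens (dfwith B A) x y =
  A (pr i x) (pr i y) * \prod_(j | j != i) B j (pr j x) (pr j y).
Proof.
rewrite /tens (bigD1 i) //= dfwith_in; congr (_ * _).
by apply: eq_bigr => j ji; rewrite dfwith_out // eq_sym.
Qed.

Lemma tens_at0 i : tens_at (0 : op R (T i)) = 0.
Proof. by apply/opP => x y; rewrite /tens_at tens_dfwithE mul0r. Qed.

Lemma tens_at_sum (J : finType) i (A : J -> op R (T i)) :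
  tens_at (\sum_j A j) = \sum_j tens_at (A j).
Proof.
apply/opP => x y; rewrite op_sumE /tens_at tens_dfwithE op_sumE mulr_suml.
by apply: eq_bigr => j _; rewrite tens_dfwithE.
Qed.

Lemma tens_at_adj i (A : op R (T i)) : op_adj (tens_at A) = tens_at (op_adj A).
Proof.
rewrite /tens_at tens_adj; apply: eq_tens => j.
have [<-|ij] := eqVneq i j; first by rewrite !dfwith_in.
by rewrite !dfwith_out // op_adj1.
Qed.

Hypothesis prodS : product_system.

Lemma sum_prod_coords (K : comNzRingType) (F : forall i, T i -> K) :
  \sum_(x : S) \prod_i F i (pr i x) = \prod_i \sum_u F i u.
Proof.
rewrite -sum_dffun_prod (reindex coords) /=; last exact: onW_bij.
by apply: eq_bigr => x _; apply: eq_bigr => i _; rewrite ffunE.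
Qed.

Lemma tens_one : tens (fun i => @op_one R (T i)) = @op_one R S.
Proof.
apply/opP => x y; rewrite /tens /op_one.
have [<-|xy] := eqVneq x y; first by rewrite big1 // => i _; rewrite eqxx.
have [i xyi] : exists i, pr i x != pr i y.
  apply/existsP; apply: contra_neqT xy => /existsPn pr_eq.
  apply: (bij_inj prodS); apply/ffunP => i; rewrite !ffunE.
  by apply/eqP; have := pr_eq i; rewrite negbK.
by rewrite (bigD1 i) //= (negPf xyi) mul0r.
Qed.

Lemma tens_mul B D :
  op_mul (tens B) (tens D) = tens (fun i => op_mul (B i) (D i)).
Proof.
apply/opP => x z; rewrite /tens /op_mul.
rewrite -(sum_prod_coords (fun i u => B i (pr i x) u * D i u (pr i z))).
by apply: eq_bigr => y _; rewrite big_split.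
Qed.

Lemma op_tr_tens B : op_tr (tens B) = \prod_i op_tr (B i).
Proof. by rewrite /op_tr /tens -(sum_prod_coords (fun i u => B i u u)). Qed.

Lemma psd_tens B : (forall i, psd (B i)) -> psd (tens B).
Proof.
move=> hB; have /(_ _)/cid-/all_sig[X BE] := fun i => psd_gramP (hB i).
have -> : tens B = op_mul (op_adj (tens X)) (op_mul (@op_one R S) (tens X)).
  by rewrite op_1mul tens_adj tens_mul; exact: eq_tens.
exact/psd_conj/psd_one.
Qed.

(* Expanding [\prod_i (B i + (D i - B i))] leaves [tens B] plus tensor products
   of positive operators. *)
Lemma psd_tensB B D : (forall i, psd (B i)) -> (forall i, psd (D i - B i)) ->
  psd (tens D - tens B).
Proof.
move=> hB hDB.
pose mixed (K : {set I}) i := if i \in K then B i else D i - B i.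
have -> : tens D = \sum_K tens (mixed K).
  apply/opP => x y; rewrite op_sumE /tens.
  under eq_bigr => i _ do rewrite -[D i _ _](subrKC (B i (pr i x) (pr i y))).
  rewrite bigA_distr; apply: eq_bigr => K _; apply: eq_bigr => i _.
  by rewrite /mixed; case: ifP.
have -> : tens B = tens (mixed [set: I]).
  by apply: eq_tens => i; rewrite /mixed inE.
rewrite (bigD1 [set: I]) //= addrAC subrr add0r.
apply: psd_sum => K _; apply: psd_tens => i; rewrite /mixed.
by case: ifP.
Qed.

Lemma tens_at_one i : tens_at (@op_one R (T i)) = @op_one R S.
Proof.
rewrite -tens_one; apply: eq_tens => j.
by have [<-|ij] := eqVneq i j; rewrite ?dfwith_in ?dfwith_out.
Qed.

Lemma tens_at_mul i (A A' : op R (T i)) :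
  op_mul (tens_at A) (tens_at A') = tens_at (op_mul A A').
Proof.
rewrite /tens_at tens_mul; apply: eq_tens => j.
have [<-|ij] := eqVneq i j; first by rewrite !dfwith_in.
by rewrite !dfwith_out // op_mul1.
Qed.

Lemma tens_at_mul_tens i (A : op R (T i)) B :
  B i = @op_one R (T i) -> op_mul (tens_at A) (tens B) = tens (dfwith B A).
Proof.
move=> Bi; rewrite /tens_at tens_mul; apply: eq_tens => j.
have [<-|ij] := eqVneq i j; first by rewrite !dfwith_in Bi op_mul1.
by rewrite !dfwith_out // op_1mul.
Qed.

Lemma tens_at_comm i (A : op R (T i)) B :
  B i = @op_one R (T i) ->
  op_mul (tens_at A) (tens B) = op_mul (tens B) (tens_at A).
Proof.
move=> Bi; rewrite /tens_at !tens_mul; apply: eq_tens => j.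
have [<-|ij] := eqVneq i j; first by rewrite !dfwith_in Bi op_mul1 op_1mul.
by rewrite !dfwith_out // op_mul1 op_1mul.
Qed.

End Product.
Arguments tens {R I S T} pr B.
Arguments tens_at {R I S T} pr {i} A.

Lemma product_system_dffun (I : finType) (T : I -> finType) :
  product_system (fun i (x : {dffun forall i, T i}) => x i).
Proof. by exists id => x; apply/ffunP => i; rewrite ffunE. Qed.

#[local] Hint Resolve product_system_dffun : core.

(** * Products of ensembles *)

Lemma Re_prod (R : rcfType) (I : finType) (z : I -> R[i]) :
  (forall i, 0 <= z i) ->
  complex.Re (\prod_i z i) = \prod_i complex.Re (z i).
Proof.
move=> z_ge0; have -> : \prod_i z i = (\prod_i complex.Re (z i))%:C%C.
  rewrite rmorph_prod; apply: eq_bigr => i _.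
  exact/esym/RRe_real/ger0_real.
by [].
Qed.

Section ProductEnsemble.
Variables (R : realType) (I S : finType) (T : I -> finType).
Variable pr : forall i, S -> T i.
Hypothesis prodS : product_system pr.
Variable E : forall i, ensemble R (T i).
Hypothesis vE : forall i, valid_ensemble (E i).

Definition prod_ens : ensemble R S :=
  @Ensemble R S {dffun forall i, e_idx (E i)}
    (fun c => \prod_i e_eta (E i) (c i))
    (fun c => tens pr (fun i => e_rho (E i) (c i))).

Definition tens_meas (M : forall i, e_idx (E i) -> op R (T i))
    (c : e_idx prod_ens) : op R S :=
  tens pr (fun i => M i (c i)).

Lemma valid_prod_ens : valid_ensemble prod_ens.
Proof.
split=> [c|]; first by apply: prodr_gt0 => i _; exact: (vE i).1.
split=> [|c].
  rewrite /= (sum_dffun_prod (fun i => e_eta (E i))) big1 // => i _.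
  exact: (vE i).2.1.
split=> /=; first by apply: psd_tens => // i; exact: ((vE i).2.2 _).1.
by rewrite op_tr_tens // big1 // => i _; exact: ((vE i).2.2 _).2.
Qed.

Lemma weighted_prod_ens (c : e_idx prod_ens) :
  weighted c = tens pr (fun i => weighted (c i)).
Proof. by apply/opP => x y; rewrite /tens big_split -rmorph_prod. Qed.

Lemma succ_tens_meas (M : forall i, e_idx (E i) -> op R (T i)) :
  (forall i, povm (M i)) ->
  @succ R _ prod_ens (tens_meas M) = \prod_i @succ R _ (E i) (M i).
Proof.
move=> hM; rewrite /succ -sum_dffun_prod; apply: eq_bigr => c _ /=.
rewrite big_split /tens_meas tens_mul // op_tr_tens // Re_prod // => i.
by apply: psd_trM_ge0; [exact: ((vE i).2.2 _).1 | exact: (hM i).1].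
Qed.

Lemma povm_tens_meas (M : forall i, e_idx (E i) -> op R (T i)) :
  (forall i, povm (M i)) -> povm (tens_meas M).
Proof.
move=> hM; split=> [c|x y].
  by apply: psd_tens => // i; exact: (hM i).1.
rewrite -(tens_one _ prodS) /tens_meas /tens.
rewrite (sum_dffun_prod (fun i j => M i j (pr i x) (pr i y))).
by apply: eq_bigr => i _; exact: (hM i).2.
Qed.

Lemma dual_values_prod (r : I -> R) :
  (forall i, dual_values (E i) (r i)) -> dual_values prod_ens (\prod_i r i).
Proof.
move=> dual_r; have /(_ _)/cid2-/all_sig2[K domK trK] := dual_r.
exists (tens pr K) => [c|].
  rewrite weighted_prod_ens; apply: psd_tensB => // i; last exact: domK.
  exact: psd_weighted.
rewrite op_tr_tens // Re_prod => [|i]; first exact: eq_bigr.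
exact/psd_tr_ge0/dominates_psd/domK.
Qed.

Lemma prod_sup_success_le (P : forall i, (e_idx (E i) -> op R (T i)) -> Prop)
    (Q : (e_idx prod_ens -> op R S) -> Prop) :
  (forall i, meas_class (P i)) -> meas_class Q ->
  (forall M, (forall i, P i (M i)) -> Q (tens_meas M)) ->
  \prod_i sup (success_values (P i)) <= sup (success_values Q).
Proof.
move=> classP classQ PQ; apply: prod_sup_le => [i|r success_r].
  exact: has_sup_success.
have /(_ _)/cid-/all_sig[M hM] := success_r.
under eq_bigr do rewrite (hM _).2.
rewrite -succ_tens_meas => [|i]; last exact: (classP i).2 _ (hM i).1.
apply: succ_le_sup; [exact: valid_prod_ens | exact: classQ | apply: PQ => i].
exact: (hM i).1.
Qed.

Lemma pG_prod_ens : pG prod_ens = \prod_i pG (E i).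
Proof.
have vP := valid_prod_ens; apply/le_anti/andP; split; last first.
  apply: prod_sup_success_le povm_tens_meas => [i|]; exact: meas_class_povm.
apply: (@closed_prod_closure _ _ [set x | pG prod_ens <= x]%classic
  (fun i => dual_values (E i))) => [|i|r dual_r].
- exact: closed_ge.
- exact: pG_closure_dual.
- exact/pG_le_dual/dual_values_prod.
Qed.

End ProductEnsemble.

(** * LOCC protocols *)

Definition complete_kraus (R : realType) (T : finType) (n : nat)
    (A : 'I_n -> op R T) : Prop :=
  forall x y, \sum_i op_mul (op_adj (A i)) (A i) x y = @op_one R T x y.

Section KrausRound.
Variables (R : realType) (T J : finType) (n : nat).
Variables (U : 'I_n -> op R T) (N : 'I_n -> J -> op R T).

Definition kraus_round (j : J) : op R T :=
  \sum_i op_mul (op_adj (U i)) (op_mul (N i j) (U i)).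

Lemma kraus_roundE : kraus_round =
  fun j x y => \sum_i op_mul (op_adj (U i)) (op_mul (N i j) (U i)) x y.
Proof.
by apply/funext => j; apply/opP => x y; rewrite /kraus_round op_sumE.
Qed.

Lemma complete_krausP :
  complete_kraus U <-> \sum_i op_mul (op_adj (U i)) (U i) = @op_one R T.
Proof.
by split=> [hU|hU x y]; [apply/opP => x y|]; rewrite -?hU op_sumE.
Qed.

Lemma povm_kraus_round :
  complete_kraus U -> (forall i, povm (N i)) -> povm kraus_round.
Proof.
move=> /complete_krausP U1 hN; apply/povmP; split=> [j|].
  by apply: psd_sum => i _; apply: psd_conj; exact: (hN i).1.
rewrite exchange_big -U1; apply: eq_bigr => i _ /=.
by rewrite -op_mul_sumr -op_mul_suml ((povmP _).1 (hN i)).2 op_1mul.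
Qed.

End KrausRound.

Lemma complete_kraus_tens_at (R : realType) (I S : finType) (T : I -> finType)
    (pr : forall i, S -> T i) i n (A : 'I_n -> op R (T i)) :
  product_system pr -> complete_kraus A ->
  complete_kraus (fun j => tens_at pr (A j)).
Proof.
move=> prodS /complete_krausP hA; apply/complete_krausP.
under eq_bigr do rewrite tens_at_adj tens_at_mul //.
by rewrite -tens_at_sum hA tens_at_one.
Qed.

Section Locc.
Variables (R : realType) (m : nat) (X : 'I_m -> finType).

Lemma lift_tens_at k (A : op R (X k)) :
  Defs.lift A = tens_at (fun k (x : gbasis X) => x k) A.
Proof.
apply/opP => x y; rewrite /tens_at tens_dfwithE /Defs.lift /op_one.
case: ifPn => [/forallP xy|/forallPn[j]].
  rewrite big1 ?mulr1 // => j jk.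
  by have := xy j; rewrite jk => /eqP ->; rewrite eqxx.
rewrite negb_imply => /andP[jk /negPf xyj].
by rewrite (bigD1 j) //= xyj mul0r mulr0.
Qed.

Lemma complete_kraus_lift k n (A : 'I_n -> op R (X k)) :
  complete_kraus A -> complete_kraus (fun i => Defs.lift (A i)).
Proof.
rewrite (funext (fun i => lift_tens_at (A i))).
exact/complete_kraus_tens_at/(@product_system_dffun _ X).
Qed.

Lemma locc_kraus_ind (J : finType) (P : (J -> op R (gbasis X)) -> Prop) :
  (forall j0, P (const_meas j0)) ->
  (forall k n (A : 'I_n -> op R (X k)) (N : 'I_n -> J -> op R (gbasis X)),
    complete_kraus A -> (forall i, P (N i)) ->
    P (kraus_round (fun i => Defs.lift (A i)) N)) ->
  forall M, locc M -> P M.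
Proof.
move=> Pstop Pround M; elim=> [|k n A N hA _ IH]; first exact: Pstop.
by rewrite -kraus_roundE; exact: Pround.
Qed.

Lemma locc_kraus_round (J : finType) k n (A : 'I_n -> op R (X k))
    (N : 'I_n -> J -> op R (gbasis X)) :
  complete_kraus A -> (forall i, locc (N i)) ->
  locc (kraus_round (fun i => Defs.lift (A i)) N).
Proof. by move=> hA hN; rewrite kraus_roundE; exact: locc_round. Qed.

Lemma locc_povm (J : finType) (M : J -> op R (gbasis X)) : locc M -> povm M.
Proof.
elim/locc_kraus_ind => [|k n A N hA IH]; first exact: const_meas_povm.
exact/povm_kraus_round/IH/complete_kraus_lift.
Qed.

Lemma meas_class_locc (J : finType) : meas_class (@locc R m X J).
Proof. by split=> [j0|]; [exact: locc_stop | exact: locc_povm]. Qed.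

Variable E : ensemble R (gbasis X).
Hypothesis vE : valid_ensemble E.

Lemma pL_gt0 : 0 < pL E.
Proof. exact/sup_success_gt0/meas_class_locc. Qed.

Lemma pL_le_pG : pL E <= pG E.
Proof. exact/sup_success_le_pG/meas_class_locc. Qed.

End Locc.

(** * LOCC protocols on several copies *)

Section Copies.
Variables (R : realType) (m : nat) (d : 'I_m -> nat) (L : nat).
Local Notation at_copy l := (tens_at (@copy m d L) (i := l)).

Lemma product_system_copy : product_system (@copy m d L).
Proof.
exists (fun c : {dffun forall l : 'I_L, Hb d} =>
  [ffun k => [ffun l => c l k] : locL d L k]) => [x|c].
  by apply/ffunP => k; apply/ffunP => l; rewrite !ffunE.
by apply/ffunP => l; apply/ffunP => k; rewrite !ffunE.
Qed.

#[local] Hint Resolve product_system_copy : core.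

Lemma tens_party_tens (B : forall k, 'I_L -> op R (loc1 d k)) :
  tens (fun k (x : HbL d L) => x k)
    (fun k => tens (fun l (a : locL d L k) => a l) (B k)) =
  tens (@copy m d L) (fun l => tens (fun k (x : Hb d) => x k) (B^~ l)).
Proof.
apply/opP => x y; rewrite /tens exchange_big; apply: eq_bigr => l _.
by apply: eq_bigr => k _; rewrite !ffunE.
Qed.

Lemma lift_at_copy (l : 'I_L) k (A : op R (loc1 d k)) :
  Defs.lift (tens_at (fun l (a : locL d L k) => a l) (i := l) A) =
  at_copy l (Defs.lift A).
Proof.
pose A_at l' := if l' == l then A else @op_one R _.
pose B k' l' := dfwith (fun k => @op_one R (loc1 d k)) (A_at l') k'.
rewrite lift_tens_at; transitivity (tens (fun k (x : HbL d L) => x k)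
    (fun k' => tens (fun l (a : locL d L k') => a l) (B k'))).
  apply: eq_tens => k'; have [<-|kk'] := eqVneq k k'.
    rewrite dfwith_in; apply: eq_tens => l'; rewrite /B dfwith_in /A_at.
    by have [<-|ll'] := eqVneq l l'; rewrite ?dfwith_in ?dfwith_out // eq_sym.
  rewrite dfwith_out // -(tens_one _ (@product_system_dffun _ (fun=> _))).
  by apply: eq_tens => l'; rewrite /B dfwith_out.
rewrite tens_party_tens; apply: eq_tens => l'.
have [<-|ll'] := eqVneq l l'.
  by rewrite dfwith_in lift_tens_at /B /A_at eqxx.
rewrite dfwith_out // /B /A_at eq_sym (negPf ll').
exact/tens_at_one/(@product_system_dffun _ (loc1 d)).
Qed.

(* The Kraus operators of [M] commute with the continuations [N j] and can thus
   be moved outside of them, where the rounds of a protocol require them. *)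
Lemma locc_bind (l : 'I_L) (J K : finType) (M : J -> op R (Hb d))
    (N : J -> K -> op R (HbL d L)) :
  locc M -> (forall j, locc (N j)) ->
  (forall j o A, op_mul (at_copy l A) (N j o) = op_mul (N j o) (at_copy l A)) ->
  locc (fun o => \sum_j op_mul (at_copy l (M j)) (N j o)).
Proof.
move=> hM hN comm; elim/locc_kraus_ind: hM => [j0|k n A M' hA IH].
  have -> : (fun o => \sum_j op_mul (at_copy l (const_meas j0 j)) (N j o)) =
      N j0; last exact: hN.
  apply/funext => o; rewrite (bigD1 j0) //= /const_meas eqxx.
  rewrite tens_at_one // op_1mul big1 ?addr0 // => j /negPf ->.
  by rewrite tens_at0 op_0mul.
have hAl := complete_kraus_tens_at (i := l) (product_system_dffun _) hA.
have := locc_kraus_round hAl IH; congr locc; apply/funext => o.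
rewrite /kraus_round; under [RHS]eq_bigr do rewrite tens_at_sum op_mul_suml.
rewrite exchange_big; apply: eq_bigr => i _ /=.
rewrite lift_at_copy op_mul_suml op_mul_sumr; apply: eq_bigr => j _.
by rewrite -!tens_at_mul // tens_at_adj -!op_mulA comm.
Qed.

Definition agree_off (I : finType) (J : I -> finType) (s : seq I)
    (c c' : {dffun forall i, J i}) : bool :=
  [forall i, (i \notin s) ==> (c i == c' i)].

Lemma agree_off_cons (I : finType) (J : I -> finType) (s : seq I) i
    (c c' : {dffun forall i, J i}) (j : J i) : i \notin s ->
  agree_off s c (finfun (dfwith c' j)) = (c i == j) && agree_off (i :: s) c c'.
Proof.
move=> si; apply/forallP/andP => [agree|[/eqP ci /forallP agree] k].
  split; first by have := agree i; rewrite si ffunE dfwith_in.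
  apply/forallP => k; have := agree k; rewrite inE negb_or ffunE.
  by have [->//|ki] := eqVneq k i; rewrite dfwith_out // eq_sym.
have := agree k; rewrite inE negb_or ffunE.
have [->|ki] := eqVneq k i; first by rewrite dfwith_in ci eqxx implybT.
by rewrite dfwith_out // eq_sym.
Qed.

Section TensorProtocol.
Variables (J : 'I_L -> finType) (M : forall l, J l -> op R (Hb d)).
Arguments M : clear implicits.
Implicit Types (c : {dffun forall l, J l}) (s : seq 'I_L).

Definition observed s c (l : 'I_L) : op R (Hb d) :=
  if l \in s then M l (c l) else @op_one R _.

(* Only the copies in [s] are measured; the other outcomes are read off [c0]. *)
Definition partial_meas s c0 c : op R (HbL d L) :=
  if agree_off s c c0 then tens (@copy m d L) (observed s c) else 0.

Lemma partial_meas_nil c0 : partial_meas [::] c0 = const_meas c0.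
Proof.
apply/funext => c; rewrite /partial_meas /const_meas tens_one //.
congr (if _ then _ else _); apply/forallP/eqP => [cc0|-> l]; last exact: eqxx.
by apply/ffunP => l; apply/eqP/cc0.
Qed.

Lemma partial_meas_cons s l c0 c : l \notin s ->
  partial_meas (l :: s) c0 c = \sum_j
    op_mul (at_copy l (M l j)) (partial_meas s (finfun (dfwith c0 j)) c).
Proof.
move=> sl; rewrite /partial_meas.
under eq_bigr do rewrite agree_off_cons //.
rewrite (bigD1 (c l)) //= eqxx /= big1 ?addr0 => [|j /negPf jc]; last first.
  by rewrite eq_sym jc op_mul0.
case: ifP => _; last by rewrite op_mul0.
rewrite tens_at_mul_tens // /observed ?(negPf sl) //.
apply: eq_tens => l'; rewrite inE.
have [->|ll'] := eqVneq l' l; first by rewrite dfwith_in.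
by rewrite dfwith_out // eq_sym.
Qed.

Hypothesis hM : forall l, locc (M l).

Lemma locc_partial_meas s c0 : uniq s -> locc (partial_meas s c0).
Proof.
elim: s c0 => [|l s IH] c0 /=.
  by rewrite partial_meas_nil => _; exact: locc_stop.
case/andP=> sl us; rewrite (funext (fun c => partial_meas_cons c0 c sl)).
apply: locc_bind => [|j|j c A]; [exact: hM | exact: IH | rewrite /partial_meas].
case: ifP => _; last by rewrite op_mul0 op_0mul.
by rewrite tens_at_comm // /observed (negPf sl).
Qed.

Lemma locc_tens : inhabited {dffun forall l, J l} ->
  locc (fun c => tens (@copy m d L) (fun l => M l (c l))).
Proof.
case=> c0; have := locc_partial_meas c0 (enum_uniq 'I_L).
congr locc; apply/funext => c; rewrite /partial_meas.
have -> : agree_off (enum 'I_L) c c0 by apply/forallP => l; rewrite mem_enum.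
by apply: eq_tens => l; rewrite /observed mem_enum.
Qed.

End TensorProtocol.

Variable E : 'I_L -> ensemble R (Hb d).
Hypothesis vE : forall l, valid_ensemble (E l).

Lemma seq_ensE : seq_ens E = prod_ens (@copy m d L) E.
Proof. by []. Qed.

Lemma valid_seq_ens : valid_ensemble (seq_ens E).
Proof. by rewrite seq_ensE; exact: valid_prod_ens. Qed.

Lemma pG_seq_ens : pG (seq_ens E) = \prod_l pG (E l).
Proof. by rewrite seq_ensE pG_prod_ens. Qed.

Lemma prod_pL_le : \prod_l pL (E l) <= pL (seq_ens E).
Proof.
apply: (prod_sup_success_le product_system_copy vE) => [l||M hM].
- exact: meas_class_locc.
- exact: meas_class_locc.
- by apply: locc_tens => //; exact: idx_inhabited valid_seq_ens.
Qed.

End Copies.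

Theorem theorem3 (R : realType) (m : nat) (d : 'I_m -> nat) (L : nat)
  (E : 'I_L -> ensemble R (Hb d)) :
  (2 <= m)%N -> (forall k, (2 <= d k)%N) -> (1 <= L)%N ->
  (forall l, valid_ensemble (E l)) ->
  ((\prod_(l < L) pL (E l) = pL (seq_ens E) /\
    pL (seq_ens E) = pG (seq_ens E))
   <-> (forall l, pL (E l) = pG (E l))).
Proof.
move=> _ _ _ vE; split=> [[prodL_seqL seqL_seqG]|LG].
  apply: ler_prod_eq => [l|]; first by rewrite pL_gt0 // pL_le_pG.
  by rewrite prodL_seqL seqL_seqG pG_seq_ens.
have seqG : pG (seq_ens E) = \prod_l pL (E l).
  by rewrite pG_seq_ens //; apply: eq_bigr => l _; rewrite LG.
have seqL : pL (seq_ens E) = \prod_l pL (E l).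
  apply/le_anti; rewrite prod_pL_le // -seqG pL_le_pG //.
  exact: valid_seq_ens.
by rewrite seqL seqG.
Qed.
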